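(* Let $\rho_{\mathrm{SB}}=\rho_{\mathrm S}\otimes\rho_{\mathrm B}$, where $\rho_{\mathrm S}=\sum_{i=1}^2s_i|s_i\rangle\langle s_i|$ is a density matrix of a qubit and $\rho_{\mathrm B}=\sum_{j=1}^{d_{\mathrm B}}b_j|b_j\rangle\langle b_j|$ a density matrix of an ancilla with Hilbert space dimension $d_{\mathrm B}$, written in their eigenbases, so that $\rho_{\mathrm{SB}}$ has eigenvalues $\lambda_{i,j}=s_ib_j$. Consider unitaries $U\in\mathrm{SU}(2d_{\mathrm B})$ for which the final joint state $\rho_{\mathrm{SB}}'=U\rho_{\mathrm{SB}}U^\dagger$ is demanded to be separable, $\rho_{\mathrm{SB}}'=\rho_{\mathrm S}'\otimes\rho_{\mathrm B}'$, and write $$\rho_{\mathrm{SB}}'=\sum_{i=1}^2\sum_{j=1}^{d_{\mathrm B}}\lambda_{i,j}'\,|s_i'\rangle\langle s_i'|\otimes|b_j'\rangle\langle b_j'|,$$ where the spectra $\{\lambda_{i,j}\}$ and $\{\lambda_{i,j}'\}$ are identical up to reordering. The final qubit purity is then $\mathcal P_{\mathrm S}=\mathrm{tr}\{\rho_{\mathrm S}'^{\,2}\}=\sum_{i=1}^2s_i'^{\,2}$ with $s_i'=\sum_{j=1}^{d_{\mathrm B}}\lambda_{i,j}'$. The largest achievable qubit purity is obtained, without loss of generality, when $U$ reshuffles the $2d_{\mathrm B}$ elements of $\{\lambda_{1,1},\dots,\lambda_{1,d_{\mathrm B}},\lambda_{2,1},\dots,\lambda_{2,d_{\mathrm B}}\}$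 such that the first half $\{\lambda_{1,1}',\dots,\lambda_{1,d_{\mathrm B}}'\}$ of the reordered set contains the $d_{\mathrm B}$ largest eigenvalues and the second half $\{\lambda_{2,1}',\dots,\lambda_{2,d_{\mathrm B}}'\}$ the remaining ones. A possible choice for $U$ is the permutation matrix that transforms the vector $(\lambda_{1,1},\dots,\lambda_{1,d_{\mathrm B}},\lambda_{2,1},\dots,\lambda_{2,d_{\mathrm B}})^\top$ into $(\lambda_{1,1}',\dots,\lambda_{1,d_{\mathrm B}}',\lambda_{2,1}',\dots,\lambda_{2,d_{\mathrm B}}')^\top$; $U$ is not unique, since for instance any local operation on the qubit or the ancilla leaves the qubit purity invariant.
   Context: A density matrix is a positive semidefinite operator of trace one. The reduced final qubit state is $\rho_{\mathrm S}'=\mathrm{tr}_{\mathrm B}\{U\rho_{\mathrm{SB}}U^\dagger\}$, with $\mathrm{tr}_{\mathrm B}$ the partial trace over the ancilla, the second tensor factor of $\mathbb C^2\otimes\mathbb C^{d_{\mathrm B}}$. $\{|s_i'\rangle\}$ and $\{|b_j'\rangle\}$ are orthonormal bases of $\mathbb C^2$ and $\mathbb C^{d_{\mathrm B}}$. Sets of eigenvalues are counted with multiplicity. The maximization is irrespective of the Hamiltonian and controls that generate $U$. The permutation matrix is understood with respect to the product eigenbasis $\{|s_i\rangle\otimes|b_j\rangle\}$.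
   Formalization: The final state is only required to be diagonal in a product basis (the displayed sum, weights need not factorize) rather than a strict product, since the reshuffled state is generally not a product; the permutation matrix gets a global phase because its determinant may be −1. *)

(* Defs.v *)
From HB Require Import structures.
From mathcomp Require Import all_boot all_order all_algebra all_fingroup.
From mathcomp Require Import reals complex.
From mathcomp Require Import sesquilinear spectral.
(* Only required, not imported: its notation [A ^t k] clashes with the one of
   sesquilinear. *)
From mathcomp Require mxtens.

Set Implicit Arguments.
Unset Strict Implicit.
Unset Printing Implicit Defensive.

Import Order.TTheory GRing.Theory Num.Theory.
Local Open Scope ring_scope.
Local Open Scope sesquilinear_scope.

(* Kronecker product; the row (or column) index [mxtens_index (i, j)] has value
   [i * n + j], so the product basis is enumerated as
   (0,0), ..., (0,n-1), (1,0), ..., (1,n-1), ... *)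
Notation "A *t B" := (mxtens.tensmx A B)
  (at level 40, left associativity, format "A  *t  B") : ring_scope.

Section QubitReset.
Variable C : numClosedFieldType.

(* [0 <= z] in [C] says that [z] is real and nonnegative, so this condition
   contains Hermiticity. *)
Definition psdmx n (A : 'M[C]_n) : Prop :=
  forall v : 'cV[C]_n, 0 <= (v^t* *m A *m v) 0 0.

Definition density n (rho : 'M[C]_n) : Prop := psdmx rho /\ \tr rho = 1.

(* [n] orthonormal vectors of C^n. *)
Definition orthonormal_basis n (e : 'I_n -> 'cV[C]_n) : Prop :=
  forall i j, ((e i)^t* *m e j) 0 0 = (i == j)%:R.

(* |u><u| *)
Definition ketbra n (u : 'cV[C]_n) : 'M[C]_n := u *m u^t*.

Definition spectral_sum n (a : 'I_n -> C) (e : 'I_n -> 'cV[C]_n) : 'M[C]_n :=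
  \sum_i a i *: ketbra (e i).

Definition special_unitary n (U : 'M[C]_n) : Prop :=
  U \is unitarymx /\ \det U = 1.

Definition evolve n (U rho : 'M[C]_n) : 'M[C]_n := U *m rho *m U^t*.

(* Partial trace over the second tensor factor. *)
Definition ptraceB m n (A : 'M[C]_(m * n)) : 'M[C]_m :=
  \matrix_(i, k) \sum_j A (mxtens.mxtens_index (i, j)) (mxtens.mxtens_index (k, j)).

Definition purity n (rho : 'M[C]_n) : C := \tr (rho *m rho).

(* The list of all [lam i j] is the list of eigenvalues of [A], with
   multiplicity. *)
Definition has_eigenvalues m n (A : 'M[C]_(m * n)) (lam : 'I_m -> 'I_n -> C)
    : Prop :=
  char_poly A = \prod_i \prod_j ('X - (lam i j)%:P).

Definition same_up_to_reordering m n (lam lam' : 'I_m -> 'I_n -> C) : Prop :=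
  perm_eq [seq lam p.1 p.2 | p : 'I_m * 'I_n] [seq lam' p.1 p.2 | p : 'I_m * 'I_n].

Definition product_basis_sum m n (lam : 'I_m -> 'I_n -> C)
    (eS : 'I_m -> 'cV[C]_m) (eB : 'I_n -> 'cV[C]_n) : 'M[C]_(m * n) :=
  \sum_i \sum_j lam i j *: (ketbra (eS i) *t ketbra (eB j)).

(* The form demanded of the final joint state. The weights [lam] need not
   factorize: sigma is separable, diagonal in a product basis, but possibly
   classically correlated. *)
Definition separable_form m n (sigma : 'M[C]_(m * n)) (lam : 'I_m -> 'I_n -> C)
    (eS : 'I_m -> 'cV[C]_m) (eB : 'I_n -> 'cV[C]_n) : Prop :=
  [/\ orthonormal_basis eS, orthonormal_basis eB
    & sigma = product_basis_sum lam eS eB].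

Definition admissible n (rho U : 'M[C]_(2 * n)) : Prop :=
  special_unitary U /\
  exists (lam : 'I_2 -> 'I_n -> C) (eS : 'I_2 -> 'cV[C]_2)
         (eB : 'I_n -> 'cV[C]_n), separable_form (evolve U rho) lam eS eB.

Definition final_qubit n (rho U : 'M[C]_(2 * n)) : 'M[C]_2 :=
  ptraceB (evolve U rho).

Definition optimal n (rho U : 'M[C]_(2 * n)) : Prop :=
  admissible rho U /\
  forall V, admissible rho V ->
    purity (final_qubit rho V) <= purity (final_qubit rho U).

Definition first_half_largest n (lam : 'I_2 -> 'I_n -> C) : Prop :=
  forall j k, lam ord_max k <= lam ord0 j.

(* (lam_{1,1}, ..., lam_{1,n}, lam_{2,1}, ..., lam_{m,n})^T *)
Definition stack m n (lam : 'I_m -> 'I_n -> C) : 'cV[C]_(m * n) :=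
  \col_k lam (mxtens.mxtens_unindex k).1 (mxtens.mxtens_unindex k).2.

Definition basis_mx n (e : 'I_n -> 'cV[C]_n) : 'M[C]_n :=
  \matrix_(r, c) e c r 0.

(* The operator whose matrix in the orthonormal basis eS i (x) eB j is the
   permutation matrix [perm_mx p]. *)
Definition perm_in_product_basis m n (eS : 'I_m -> 'cV[C]_m)
    (eB : 'I_n -> 'cV[C]_n) (p : 'S_(m * n)) : 'M[C]_(m * n) :=
  let W := basis_mx eS *t basis_mx eB in W *m perm_mx p *m W^t*.

End QubitReset.

(* Main.v *)
Require Import Defs.
From mathcomp Require Import all_boot all_order all_algebra all_fingroup.
From mathcomp Require Import reals complex.
From mathcomp Require Import ring.
From mathcomp Require Import sesquilinear spectral.

(** The first-half and second-half sums of a spectrum add up to a constant, so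
    with M, m those of a spectrum sorted with the largest half first, and a, b
    those of a reordering, a^2 + b^2 = M^2 + m^2 - 2 (M - a) (M - b).  Both
    factors are nonnegative, which gives optimality.  For uniqueness, take a
    threshold t separating the two sorted halves: M - a is a sum of nonnegative
    terms measuring how far entries of the first half fall below t and how far
    entries of the second half exceed t, so M = a forces the first half to
    contain the largest eigenvalues; M = b is the same after relabelling.  A
    qubit phase diag(i, -i) (x) 1 has determinant 1 and is not scalar, so it
    turns an optimal unitary into an essentially different one. *)

Set Implicit Arguments.
Unset Strict Implicit.
Unset Printing Implicit Defensive.

Import Order.TTheory GRing.Theory Num.Theory.
Local Open Scope ring_scope.
Local Open Scope sesquilinear_scope.

Import mxtens.

Section QubitPurity.
Variable C : numClosedFieldType.

(** * Product bases and spectra *)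

Lemma unitarymxPr n (U : 'M[C]_n) :
  reflect (U^t* *m U = 1%:M) (U \is unitarymx).
Proof. by rewrite -trmxC_unitary; apply: (iffP (unitarymxP)); rewrite trmxCK. Qed.

Lemma trmxC_mul m n p (A : 'M[C]_(m, n)) (B : 'M_(n, p)) :
  (A *m B)^t* = B^t* *m A^t*.
Proof. by rewrite trmx_mul map_mxM. Qed.

Lemma trmxC_tens m n p q (A : 'M[C]_(m, n)) (B : 'M_(p, q)) :
  (A *t B)^t* = A^t* *t B^t*.
Proof. by rewrite trmx_tens map_mxT. Qed.

Lemma tensmx11 m n : 1%:M *t 1%:M = 1%:M :> 'M[C]_(m * n).
Proof.
apply/matrixP => a b; case: (mxtens_indexP a) => i j.
case: (mxtens_indexP b) => k l; rewrite tensmxE !mxE.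
by rewrite (can_eq (@mxtens_indexK _ _)) xpair_eqE -natrM mulnb.
Qed.

Lemma unitarymx_tens m n (A : 'M[C]_m) (B : 'M_n) :
  A \is unitarymx -> B \is unitarymx -> A *t B \is unitarymx.
Proof.
move=> /unitarymxP uA /unitarymxP uB; apply/unitarymxP.
by rewrite trmxC_tens tensmx_mul uA uB tensmx11.
Qed.

Lemma orthonormal_basisP n (e : 'I_n -> 'cV[C]_n) :
  orthonormal_basis e <-> basis_mx e \is unitarymx.
Proof.
have E i j : ((basis_mx e)^t* *m basis_mx e) i j = ((e i)^t* *m e j) 0 0.
  by rewrite !mxE; apply: eq_bigr => k _; rewrite !mxE.
split=> [eb|/unitarymxPr eb i j]; last by rewrite -E eb mxE.
by apply/unitarymxPr/matrixP => i j; rewrite E eb mxE.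
Qed.

Lemma basis_mx_col n (U : 'M[C]_n) : basis_mx (fun j => col j U) = U.
Proof. by apply/matrixP => i j; rewrite !mxE. Qed.

Lemma basis_mx_mul n (U : 'M[C]_n) (e : 'I_n -> 'cV[C]_n) :
  basis_mx (fun j => U *m e j) = U *m basis_mx e.
Proof.
by apply/matrixP => i j; rewrite !mxE; apply: eq_bigr => k _; rewrite mxE.
Qed.

Lemma spectral_sumE n (a : 'I_n -> C) (e : 'I_n -> 'cV[C]_n) :
  spectral_sum a e = basis_mx e *m diag_mx (\row_i a i) *m (basis_mx e)^t*.
Proof.
apply/matrixP => i j; rewrite mul_mx_diag summxE mxE; apply: eq_bigr => k _.
by rewrite !mxE big_ord_recl big_ord0 addr0 !mxE mulrCA mulrA.
Qed.

(** For orthonormal bases [W] is unitary, so this form reduces spectra, permutations and local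
    operations to computations with a diagonal matrix. *)
Lemma product_basis_sumE m n (lam : 'I_m -> 'I_n -> C)
    (eS : 'I_m -> 'cV[C]_m) (eB : 'I_n -> 'cV[C]_n) :
  let W := basis_mx eS *t basis_mx eB in
  product_basis_sum lam eS eB = W *m diag_mx (stack lam)^T *m W^t*.
Proof.
move=> W; rewrite /product_basis_sum pair_bigA /=.
apply/matrixP => a b; rewrite mul_mx_diag summxE mxE.
rewrite (reindex (@mxtens_unindex m n)) /=; last first.
  by exists (@mxtens_index m n) => ? _; rewrite ?mxtens_indexK ?mxtens_unindexK.
apply: eq_bigr => k _; rewrite !mxE rmorphM /= !big_ord1 !mxE.
ring.
Qed.

Lemma char_poly_unitary n (W A : 'M[C]_n) :
  W \is unitarymx -> char_poly (W *m A *m W^t*) = char_poly A.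
Proof.
move=> /unitarymxP WW; pose f := map_mx (@polyC C).
have fW : f _ _ W *m f _ _ (W^t*) = 1%:M by rewrite -map_mxM WW map_mx1.
rewrite /char_poly /char_poly_mx !map_mxM -!/(f _ _ _).
(* Scalar matrices commute with [W], so the indeterminate is conjugated along with [A] and the
   determinants of [W] and its adjoint cancel. *)
rewrite [in LHS](_ : 'X%:M = f _ _ W *m 'X%:M *m f _ _ (W^t*)); last first.
  by rewrite -mulmxA -scalar_mxC mulmxA fW mul1mx.
by rewrite -mulmxBl -mulmxBr !det_mulmx mulrAC -det_mulmx fW det1 mul1r.
Qed.

Lemma char_poly_diag n (d : 'rV[C]_n) :
  char_poly (diag_mx d) = \prod_i ('X - (d 0 i)%:P).
Proof.
rewrite char_poly_trig ?diag_mx_is_trig//.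
by apply: eq_bigr => i _; rewrite mxE eqxx mulr1n.
Qed.

Lemma char_poly_product_basis_sum m n (lam : 'I_m -> 'I_n -> C)
    (eS : 'I_m -> 'cV[C]_m) (eB : 'I_n -> 'cV[C]_n) :
  orthonormal_basis eS -> orthonormal_basis eB ->
  has_eigenvalues (product_basis_sum lam eS eB) lam.
Proof.
move=> /orthonormal_basisP uS /orthonormal_basisP uB.
rewrite /has_eigenvalues product_basis_sumE char_poly_unitary ?unitarymx_tens//.
rewrite char_poly_diag pair_bigA (reindex (@mxtens_unindex m n)) /=.
  by apply: eq_bigr => k _; rewrite !mxE.
by exists (@mxtens_index m n) => ? _; rewrite ?mxtens_indexK ?mxtens_unindexK.
Qed.

(** A product of monic linear factors determines its roots with multiplicity. *)
Lemma eigenvalues_reordering m n (A : 'M[C]_(m * n)) (lam lam' : 'I_m -> 'I_n -> C) :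
  has_eigenvalues A lam -> has_eigenvalues A lam' ->
  same_up_to_reordering lam lam'.
Proof.
rewrite /has_eigenvalues => -> E; apply: prod_XsubC_eq.
by rewrite !big_image /= -(pair_bigA _ (fun i j => 'X - (lam i j)%:P)) /= E pair_bigA.
Qed.

Lemma spectral_sum_tens m n (s : 'I_m -> C) (b : 'I_n -> C)
    (eS : 'I_m -> 'cV[C]_m) (eB : 'I_n -> 'cV[C]_n) :
  spectral_sum s eS *t spectral_sum b eB =
    product_basis_sum (fun i j => s i * b j) eS eB.
Proof.
rewrite product_basis_sumE !spectral_sumE trmxC_tens -!tensmx_mul.
congr (_ *m _ *m _); apply/matrixP => a c; rewrite [LHS]mxE !mxE.
rewrite mulrnAl mulrnAr -mulrnA mulnb andbC -xpair_eqE -!surjective_pairing.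
by rewrite (can_eq (@mxtens_unindexK _ _)).
Qed.

Lemma char_poly_evolve n (U rho : 'M[C]_n) :
  special_unitary U -> char_poly (evolve U rho) = char_poly rho.
Proof. by case=> uU _; rewrite char_poly_unitary. Qed.

Lemma tr_ketbra n (u : 'cV[C]_n) : \tr (ketbra u) = (u^t* *m u) 0 0.
Proof. by rewrite /ketbra mxtrace_mulC trace_mx11. Qed.

(** * Partial trace and purity *)

Lemma ptraceB_tens m n (A : 'M[C]_m) (B : 'M[C]_n) :
  ptraceB (A *t B) = \tr B *: A.
Proof.
apply/matrixP => i k; rewrite !mxE mulr_suml; apply: eq_bigr => j _.
by rewrite tensmxE mulrC.
Qed.

Lemma ptraceB_sum m n I (r : seq I) (F : I -> 'M[C]_(m * n)) :
  ptraceB (\sum_(i <- r) F i) = \sum_(i <- r) ptraceB (F i).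
Proof.
apply/matrixP => i k; rewrite mxE summxE; under [RHS]eq_bigr do rewrite mxE.
by rewrite exchange_big; apply: eq_bigr => j _; rewrite summxE.
Qed.

Lemma ptraceBZ m n (a : C) (A : 'M[C]_(m * n)) :
  ptraceB (a *: A) = a *: ptraceB A.
Proof.
by apply/matrixP => i k; rewrite !mxE mulr_sumr; apply: eq_bigr => j _; rewrite mxE.
Qed.

Lemma ptraceB_product_basis_sum m n (lam : 'I_m -> 'I_n -> C)
    (eS : 'I_m -> 'cV[C]_m) (eB : 'I_n -> 'cV[C]_n) :
  orthonormal_basis eB ->
  ptraceB (product_basis_sum lam eS eB) =
    spectral_sum (fun i => \sum_j lam i j) eS.
Proof.
move=> oB; rewrite ptraceB_sum; apply: eq_bigr => i _; rewrite ptraceB_sum.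
rewrite scaler_suml; apply: eq_bigr => j _; rewrite ptraceBZ ptraceB_tens.
by rewrite tr_ketbra oB eqxx scale1r.
Qed.

Lemma purity_unitary n (U A : 'M[C]_n) :
  U \is unitarymx -> purity (U *m A *m U^t*) = purity A.
Proof.
move=> uU; rewrite /purity !mulmxA mulmxKtV// mxtrace_mulC !mulmxA.
by rewrite (unitarymxPr _ uU) mul1mx.
Qed.

Lemma purity_spectral_sum n (a : 'I_n -> C) (e : 'I_n -> 'cV[C]_n) :
  orthonormal_basis e -> purity (spectral_sum a e) = \sum_i a i ^+ 2.
Proof.
move=> /orthonormal_basisP ue; rewrite spectral_sumE purity_unitary//.
rewrite /purity mulmx_diag mxtrace_diag; apply: eq_bigr => i _.
by rewrite !mxE expr2.
Qed.

Lemma ptraceB_local m n (VS : 'M[C]_m) (VB : 'M[C]_n) (A : 'M[C]_(m * n)) :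
  VB \is unitarymx ->
  ptraceB ((VS *t VB) *m A *m (VS *t VB)^t*) = VS *m ptraceB A *m VS^t*.
Proof.
(* Expanding [A] in tensor products of matrix units reduces the claim, by linearity, to pure
   tensors, where cyclicity of the trace removes [VB]. *)
move=> uB; have AE : A = \sum_(p : ('I_m * 'I_n) * ('I_m * 'I_n))
    A (mxtens_index p.1) (mxtens_index p.2) *:
    (delta_mx p.1.1 p.2.1 *t delta_mx p.1.2 p.2.2).
  apply/matrixP => a b; case: (mxtens_indexP a) => i j.
  case: (mxtens_indexP b) => k l; rewrite summxE (bigD1 ((i, j), (k, l))) //=.
  rewrite big1 => [|[[i' j'] [k' l']] /=]; rewrite mxE tensmxE !mxE.
    by rewrite !eqxx !mulr1 addr0.
  rewrite !xpair_eqE -natrM mulnb => ne; rewrite [X in nat_of_bool X](_ : _ = false) ?mulr0//.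
  apply: contraNF ne.
  by case/andP=> /andP[/eqP-> /eqP->] /andP[/eqP-> /eqP->]; rewrite !eqxx.
rewrite [in LHS]AE [in RHS]AE mulmx_sumr mulmx_suml !ptraceB_sum.
rewrite mulmx_sumr mulmx_suml; apply: eq_bigr => p _.
rewrite -scalemxAr -scalemxAl !ptraceBZ -scalemxAr -scalemxAl; congr (_ *: _).
rewrite trmxC_tens !tensmx_mul !ptraceB_tens -scalemxAr -scalemxAl.
by rewrite mxtrace_mulC mulmxA (unitarymxPr _ uB) mul1mx.
Qed.

(** * Positive semidefinite matrices *)

Lemma psdmx_hermsymmx n (A : 'M[C]_n) : psdmx A -> A \is hermsymmx.
Proof.
move=> psdA; pose B := A - A^t*.
pose q (u v : 'cV[C]_n) := (u^t* *m B *m v) 0 0.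
have qDl u v w : q (u + v) w = q u w + q v w.
  rewrite /q.
  have -> : (u + v)^t* = u^t* + v^t* by apply/matrixP => i j; rewrite !mxE rmorphD.
  by rewrite !mulmxDl mxE.
have qDr u v w : q u (v + w) = q u v + q u w by rewrite /q mulmxDr mxE.
have qZl a u v : q (a *: u) v = a^* * q u v.
  rewrite /q.
  have -> : (a *: u)^t* = a^* *: u^t* by apply/matrixP => i j; rewrite !mxE rmorphM.
  by rewrite -!scalemxAl mxE.
have qZr a u v : q u (a *: v) = a * q u v by rewrite /q -scalemxAr mxE.
(* Polarization: q vanishes on the diagonal, hence everywhere. *)
have q0 v : q v v = 0.
  rewrite /q mulmxBr mulmxBl; set M := _ *m _ *m v.
  have -> : v^t* *m A^t* *m v = M^t* by rewrite !trmxC_mul trmxCK mulmxA.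
  have M00 : (M 0 0)^* = M 0 0 by apply/CrealP/ger0_real/psdA.
  have -> : (M - M^t*) 0 0 = M 0 0 - (M 0 0)^* by clearbody M; rewrite !mxE.
  by rewrite M00 subrr.
have qs u v : q u v + q v u = 0.
  by have := q0 (u + v); rewrite qDl !qDr !q0 addr0 add0r.
(* Replacing v by iv in [qs] turns the antisymmetry of [q] into symmetry, because [q] is
   conjugate-linear on the left; both together give 2 q = 0. *)
have q_eq0 u v : q u v = 0.
  have := qs u ('i *: v); rewrite qZr qZl conjCi mulNr -mulrBr => /eqP.
  rewrite mulf_eq0 (negPf (neq0Ci _)) /= subr_eq0 => /eqP e.
  by have /eqP := qs u v; rewrite -e -mulr2n mulrn_eq0 => /eqP.
apply/is_hermitianmxP; rewrite expr0 scale1r; apply/eqP; rewrite -subr_eq0.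
(* The entries of [B] are the values of [q] on standard basis vectors. *)
apply/eqP/matrixP => i j; rewrite -/B [RHS]mxE -(q_eq0 (delta_mx i 0) (delta_mx j 0)).
by rewrite /q -mulmxA -colE trmx_delta map_delta_mx -rowE !mxE.
Qed.

Lemma psdmx_spectral n (A : 'M[C]_n) : psdmx A ->
  exists (a : 'I_n -> C) (e : 'I_n -> 'cV[C]_n),
    orthonormal_basis e /\ A = spectral_sum a e.
Proof.
move=> /psdmx_hermsymmx /hermitian_normalmx /orthomx_spectralP ->.
have uP := spectral_unitarymx A.
(* The spectral theorem reads A = P^* D P with P = [spectralmx A], so the eigenvectors are the
   columns of P^*. *)
exists (fun i => spectral_diag A 0 i), (fun j => col j ((spectralmx A)^t*)).
split; first by apply/orthonormal_basisP; rewrite basis_mx_col trmxC_unitary.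
rewrite spectral_sumE basis_mx_col trmxCK invmx_unitary//.
by congr (_ *m diag_mx _ *m _); apply/rowP => j; rewrite mxE.
Qed.

Lemma psdmx_spectral_sum_ge0 n (a : 'I_n -> C) (e : 'I_n -> 'cV[C]_n) :
  orthonormal_basis e -> psdmx (spectral_sum a e) -> forall i, 0 <= a i.
Proof.
move=> oe psd i; have := psd (e i).
rewrite mulmx_sumr mulmx_suml summxE (bigD1 i) //= big1 => [|j ji].
  rewrite /ketbra -scalemxAr -scalemxAl mulmxA -(mulmxA (_ *m e i)) mxE.
  by rewrite mxE big_ord1 !oe eqxx !mulr1 addr0.
rewrite /ketbra -scalemxAr -scalemxAl mulmxA -(mulmxA (_ *m e j)) mxE mxE big_ord1 !oe.
by rewrite (negPf ji) mulr0 mulr0.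
Qed.

(** * Reorderings of a two-block spectrum *)

(** The function [f] is arbitrary in order to cover both the conserved total (the identity) and the
    conserved excess over a threshold. *)
Lemma reordering_sum m n (lam lam' : 'I_m -> 'I_n -> C) (f : C -> C) :
  same_up_to_reordering lam lam' ->
  \sum_i \sum_j f (lam i j) = \sum_i \sum_j f (lam' i j).
Proof.
move=> ss; rewrite !pair_bigA /= -(big_image _ _ (fun p => lam p.1 p.2) xpredT).
by rewrite (perm_big _ ss) big_image.
Qed.

(** The order on [C] is partial; realness is what makes the entries of a reordered spectrum
    comparable with a threshold. *)
Lemma reordering_real m n (lam lam' : 'I_m -> 'I_n -> C) :
  same_up_to_reordering lam lam' -> (forall i j, lam i j \is Num.real) ->
  forall i j, lam' i j \is Num.real.
Proof.
move=> ss lamR i j.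
have : lam' i j \in [seq lam p.1 p.2 | p : 'I_m * 'I_n].
  by rewrite (perm_mem ss); apply: (image_f (fun p => lam' p.1 p.2) (x := (i, j))).
by case/imageP => p _ ->.
Qed.

Lemma first_half_threshold n (lam : 'I_2 -> 'I_n -> C) : (0 < n)%N ->
  (forall i j, lam i j \is Num.real) -> first_half_largest lam ->
  exists2 t, t \is Num.real & forall j, lam ord_max j <= t <= lam ord0 j.
Proof.
case: n lam => // n lam _ lamR fh.
(* The threshold is the smallest entry of the first half, which exists since that half is
   nonempty. *)
have [|j0 _ j0P] := @real_arg_minP C _ ord0 xpredT (lam ord0) isT.
  by move=> j _; apply: lamR.
by exists (lam ord0 j0) => // j; rewrite fh j0P.
Qed.

(* The sum of the excesses max (x - t) 0 over the whole spectrum is invariant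
   under reordering. *)
Lemma first_half_sum_gap n (lam lam' : 'I_2 -> 'I_n -> C) (t : C) (i : 'I_2) :
  (forall i j, lam i j \is Num.real) -> t \is Num.real ->
  (forall j, lam ord_max j <= t <= lam ord0 j) ->
  same_up_to_reordering lam lam' ->
  \sum_j lam ord0 j - \sum_j lam' i j =
    \sum_j Num.max 0 (t - lam' i j)
    + \sum_(k | k != i) \sum_j Num.max (lam' k j - t) 0.
Proof.
move=> lamR tR tP ss; have lamR' := reordering_real ss lamR.
have := reordering_sum (fun x => Num.max (x - t) 0) ss.
rewrite big_ord_recl big_ord1 /= (bigD1 i) //=.
have -> : lift ord0 ord0 = ord_max :> 'I_2 by apply: val_inj.
(* In the sorted spectrum the first half lies above [t] and the second below, so the total excess is
   the first-half sum minus n t. *)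
have -> : \sum_j Num.max (lam ord0 j - t) 0 = \sum_j (lam ord0 j - t).
  apply: eq_bigr => j _; apply: max_l; rewrite subr_ge0.
  by have /andP[] := tP j.
have -> : \sum_j Num.max (lam ord_max j - t) 0 = 0.
  rewrite big1 // => j _; apply: max_r; rewrite subr_le0.
  by have /andP[] := tP j.
rewrite addr0 sumrB => E.
(* Termwise, the positive part minus the number itself is the negative part: max(0, -x) = max(x, 0)
   - x with x = [lam' i j - t]. *)
have -> : \sum_j Num.max 0 (t - lam' i j) =
    \sum_j Num.max (lam' i j - t) 0 - \sum_j (lam' i j - t).
  rewrite -sumrB; apply: eq_bigr => j _.
  have [h|/ltW h] := real_leP tR (lamR' i j).
    by rewrite !max_l ?subrr // ?subr_ge0 ?subr_le0.
  by rewrite !max_r ?sub0r ?opprB // ?subr_ge0 ?subr_le0.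
rewrite addrAC -E sumrB; ring.
Qed.

Lemma maxr_ge0l (x : C) : x \is Num.real -> 0 <= Num.max 0 x.
Proof. by move=> xR; case: (real_leP (real0 C) xR). Qed.

Lemma maxr_ge0r (x : C) : x \is Num.real -> 0 <= Num.max x 0.
Proof. by move=> xR; case: (real_leP xR (real0 C)) => // /ltW. Qed.

Section Majorization.
Variables (n : nat) (lam lam' : 'I_2 -> 'I_n -> C).
Hypotheses (n_gt0 : (0 < n)%N) (lamR : forall i j, lam i j \is Num.real).
Hypotheses (fh : first_half_largest lam) (ss : same_up_to_reordering lam lam').

Lemma first_half_sum_le i : \sum_j lam' i j <= \sum_j lam ord0 j.
Proof.
have lamR' := reordering_real ss lamR.
have [t tR tP] := first_half_threshold n_gt0 lamR fh.
rewrite -subr_ge0 (first_half_sum_gap i lamR tR tP ss) addr_ge0 ?sumr_ge0 // => k _.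
  by rewrite maxr_ge0l ?realB.
by rewrite sumr_ge0 // => j _; rewrite maxr_ge0r ?realB.
Qed.

(** Equality of the sums closes the gap of [first_half_sum_gap], so each of its nonnegative terms
    vanishes. *)
Lemma first_half_sum_eq i : \sum_j lam' i j = \sum_j lam ord0 j ->
  forall k j l, k != i -> lam' k l <= lam' i j.
Proof.
move=> E k j l ki; have lamR' := reordering_real ss lamR.
have [t tR tP] := first_half_threshold n_gt0 lamR fh.
have ge0l j' : 0 <= Num.max 0 (t - lam' i j') by rewrite maxr_ge0l ?realB.
have ge0r k' j' : 0 <= Num.max (lam' k' j' - t) 0 by rewrite maxr_ge0r ?realB.
have := first_half_sum_gap i lamR tR tP ss; rewrite E subrr => /esym /eqP.
rewrite paddr_eq0 ?sumr_ge0 // => [|k' _]; last by rewrite sumr_ge0.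
case/andP=> /eqP /psumr_eq0P zl /eqP /psumr_eq0P zr.
(* The same threshold separates the reordered halves: [zr] puts the other half below [t], and [zl]
   puts half [i] above it. *)
apply: (@le_trans _ _ t).
  have /eqP := zr (fun k' _ => sumr_ge0 _ (fun j' _ => ge0r k' j')) k ki.
  rewrite psumr_eq0 // => /allP /(_ l (mem_index_enum _)) /= /eqP.
  by case: (real_leP (realB (lamR' k l) tR) (real0 C)) => [|+ e];
    rewrite ?subr_le0// e ltxx.
have := zl (fun j' _ => ge0l j') j isT.
case: (real_leP (real0 C) (realB tR (lamR' i j))) => [_ e|+ _].
  by rewrite -subr_le0 e.
by rewrite subr_lt0 => /ltW.
Qed.

(** A polynomial identity once the conserved total is substituted. The loss of purity comes out as a
    product, so its sign and its vanishing can be read off the factors. *)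
Lemma two_halves_purity :
  \sum_i (\sum_j lam' i j) ^+ 2 = \sum_i (\sum_j lam i j) ^+ 2
    - 2 * ((\sum_j lam ord0 j - \sum_j lam' ord0 j) *
           (\sum_j lam ord0 j - \sum_j lam' ord_max j)).
Proof.
have := reordering_sum id ss; rewrite !(big_ord_recl, big_ord0) /= !addr0.
have -> : lift ord0 ord0 = ord_max :> 'I_2 by apply: val_inj.
set a := \sum_j lam ord0 j; set b := \sum_j lam ord_max j.
by move=> /(canRL (addrK _)) ->; ring.
Qed.

Lemma purity_first_half_ge :
  \sum_i (\sum_j lam' i j) ^+ 2 <= \sum_i (\sum_j lam i j) ^+ 2.
Proof.
rewrite two_halves_purity gerBl mulr_ge0 ?ler0n// mulr_ge0//.
all: by rewrite subr_ge0 first_half_sum_le.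
Qed.

(** One factor of the loss must vanish; which one tells the half that holds the largest eigenvalues,
    and [rev_ord] exchanges the two labels. *)
Lemma purity_first_half_eq :
  \sum_i (\sum_j lam i j) ^+ 2 <= \sum_i (\sum_j lam' i j) ^+ 2 ->
  first_half_largest lam' \/ first_half_largest (fun i => lam' (rev_ord i)).
Proof.
move=> le; have /eqP : \sum_i (\sum_j lam' i j) ^+ 2 = \sum_i (\sum_j lam i j) ^+ 2.
  by apply/eqP; rewrite eq_le le purity_first_half_ge.
rewrite two_halves_purity -subr_eq0 addrAC subrr sub0r oppr_eq0 !mulf_eq0.
rewrite pnatr_eq0 /= !subr_eq0 => /orP[] /eqP /esym e; [left|right] => j k.
  exact: first_half_sum_eq.
have -> : rev_ord ord0 = ord_max :> 'I_2 by apply: val_inj.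
exact: first_half_sum_eq.
Qed.

End Majorization.

Lemma sorting_reshuffle n (lam : 'I_2 -> 'I_n -> C) :
  (forall i j, lam i j \is Num.real) ->
  exists (p : 'S_(2 * n)) (lam' : 'I_2 -> 'I_n -> C),
    perm_mx p *m stack lam = stack lam' /\ first_half_largest lam'.
Proof.
move=> lamR; pose t := [tuple stack lam k 0 | k < 2 * n].
have tR : all (mem Num.real) t.
  by apply/allP => x /mapP[k _ ->]; rewrite mxE /=; apply: lamR.
(* Sorting in decreasing order is justified only among real entries, where the order is total. *)
have ge_total : {in Num.real &, total (fun x y : C => y <= x)}.
  by move=> x y xR yR; case: (real_leP yR xR) => // /ltW.
have ge_trans : transitive (fun x y : C => y <= x).
  by move=> y x z yx zy; apply: le_trans zy yx.
pose r := sort (fun x y : C => y <= x) t.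
have rs : sorted (fun x y : C => y <= x) r.
  exact: (sort_sorted_in ge_total tR).
have /tuple_permP[p rE] : perm_eq r t by rewrite perm_sort.
exists p, (fun i j => stack lam (p (mxtens_index (i, j))) 0).
split.
  rewrite -row_permE; apply/colP => k.
  by rewrite !mxE -(mxtens_unindexK k) !mxtens_indexK mxtens_unindexK.
have nthr k : nth 0 r (val k) = stack lam (p k) 0.
  by rewrite rE -tnth_nth !tnth_mktuple.
(* The flattened index of (0, j) is j < n and that of (1, k) is n + k, so a decreasing list has its
   largest entries in the first half. *)
move=> j k; rewrite -!nthr; apply: (sorted_leq_nth ge_trans _ 0 rs) => //.
- by rewrite inE /= size_sort size_tuple; apply: (valP (mxtens_index (ord0, j))).
- by rewrite inE /= size_sort size_tuple; apply: (valP (mxtens_index (ord_max, k))).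
- by rewrite /= mul0n add0n mul1n (leq_trans (ltnW (ltn_ord j))) ?leq_addr.
Qed.

(** * Unitary evolution *)

Lemma evolve_mul n (V U rho : 'M[C]_n) :
  evolve (V *m U) rho = V *m evolve U rho *m V^t*.
Proof. by rewrite /evolve trmxC_mul !mulmxA. Qed.

Lemma evolve_phase n (c : C) (U rho : 'M[C]_n) :
  `|c| = 1 -> evolve (c *: U) rho = evolve U rho.
Proof.
move=> c1; rewrite /evolve; have -> : (c *: U)^t* = c^* *: U^t*.
  by apply/matrixP => i j; rewrite !mxE rmorphM.
by rewrite -!scalemxAl -scalemxAr scalerA -normCK c1 expr1n scale1r.
Qed.

Lemma special_unitary_phase n (U : 'M[C]_n) : (0 < n)%N -> U \is unitarymx ->
  exists c : C, `|c| = 1 /\ special_unitary (c *: U).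
Proof.
move=> n0 uU; have dU : `|\det U| = 1.
  have /(congr1 determinant) := unitarymxP uU.
  rewrite det_mulmx det_map_mx det_tr det1 -normCK => /eqP.
  by rewrite pexpr_eq1 // => /eqP.
(* Scaling by c multiplies the determinant by c^n, here the inverse of [\det U]; it is a phase
   because that determinant has modulus 1. *)
pose c := n.-root (\det U)^-1.
have c1 : `|c| = 1 by rewrite norm_rootC normfV dU invr1 rootC1.
exists c; split=> //; split.
  (* Unitarity of cU is the invariance of [evolve] under a phase, applied to the identity matrix. *)
  apply/unitarymxP; rewrite -[RHS](unitarymxP uU).
  have := evolve_phase U 1%:M c1; rewrite /evolve !mulmx1; exact.
by rewrite detZ rootCK // mulVf // -normr_gt0 dU.
Qed.

(** This links the two roles of the permutation matrix: acting on the vector of eigenvalues and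
    conjugating the state. *)
Lemma perm_diag_mx n (p : 'S_n) (v : 'cV[C]_n) :
  perm_mx p *m diag_mx v^T *m (perm_mx p)^t* = diag_mx (perm_mx p *m v)^T.
Proof.
rewrite tr_perm_mx map_perm_mx -row_permE -col_permE -row_permE.
by apply/matrixP => i j; rewrite !mxE (inj_eq perm_inj).
Qed.

Lemma unitary_perm_mx n (p : 'S_n) : perm_mx p \is @unitarymx C n n.
Proof.
by apply/unitarymxP; rewrite tr_perm_mx map_perm_mx -perm_mxM mulgV perm_mx1.
Qed.

Lemma perm_in_product_basis_unitary m n (eS : 'I_m -> 'cV[C]_m)
    (eB : 'I_n -> 'cV[C]_n) (p : 'S_(m * n)) :
  orthonormal_basis eS -> orthonormal_basis eB ->
  perm_in_product_basis eS eB p \is unitarymx.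
Proof.
move=> /orthonormal_basisP uS /orthonormal_basisP uB.
have uW := unitarymx_tens uS uB.
by rewrite !mul_unitarymx ?trmxC_unitary ?unitary_perm_mx.
Qed.

Lemma evolve_perm_in_product_basis m n (lam lam' : 'I_m -> 'I_n -> C)
    (eS : 'I_m -> 'cV[C]_m) (eB : 'I_n -> 'cV[C]_n) (p : 'S_(m * n)) :
  orthonormal_basis eS -> orthonormal_basis eB ->
  perm_mx p *m stack lam = stack lam' ->
  evolve (perm_in_product_basis eS eB p) (product_basis_sum lam eS eB) =
    product_basis_sum lam' eS eB.
Proof.
move=> /orthonormal_basisP uS /orthonormal_basisP uB E.
have uW := unitarymx_tens uS uB.
rewrite !product_basis_sumE -E -perm_diag_mx /evolve /perm_in_product_basis.
by rewrite !trmxC_mul trmxCK !mulmxA !(mulmxKtV _ uW).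
Qed.

Lemma separable_form_local m n (VS : 'M[C]_m) (VB : 'M[C]_n) (A : 'M[C]_(m * n))
    (lam : 'I_m -> 'I_n -> C) (eS : 'I_m -> 'cV[C]_m) (eB : 'I_n -> 'cV[C]_n) :
  VS \is unitarymx -> VB \is unitarymx -> separable_form A lam eS eB ->
  separable_form ((VS *t VB) *m A *m (VS *t VB)^t*) lam
    (fun i => VS *m eS i) (fun j => VB *m eB j).
Proof.
move=> uS uB [/orthonormal_basisP oS /orthonormal_basisP oB ->]; split.
- by apply/orthonormal_basisP; rewrite basis_mx_mul mul_unitarymx.
- by apply/orthonormal_basisP; rewrite basis_mx_mul mul_unitarymx.
by rewrite !product_basis_sumE !basis_mx_mul -tensmx_mul trmxC_mul !mulmxA.
Qed.

Lemma admissible_local n (VS : 'M[C]_2) (VB : 'M[C]_n) (rho U : 'M[C]_(2 * n)) :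
  VS \is unitarymx -> VB \is unitarymx ->
  special_unitary ((VS *t VB) *m U) -> admissible rho U ->
  admissible rho ((VS *t VB) *m U).
Proof.
move=> uS uB suVU [_ [lam [eS [eB sf]]]]; split=> //.
exists lam, (fun i => VS *m eS i), (fun j => VB *m eB j).
by rewrite evolve_mul; apply: separable_form_local.
Qed.

Lemma purity_final_qubit_local n (VS : 'M[C]_2) (VB : 'M[C]_n)
    (rho U : 'M[C]_(2 * n)) :
  VS \is unitarymx -> VB \is unitarymx ->
  purity (final_qubit rho ((VS *t VB) *m U)) = purity (final_qubit rho U).
Proof.
move=> uS uB; rewrite /final_qubit evolve_mul ptraceB_local //.
exact: purity_unitary.
Qed.

Lemma optimal_local n (VS : 'M[C]_2) (VB : 'M[C]_n) (rho U : 'M[C]_(2 * n)) :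
  VS \is unitarymx -> VB \is unitarymx ->
  special_unitary ((VS *t VB) *m U) -> optimal rho U ->
  optimal rho ((VS *t VB) *m U).
Proof.
move=> uS uB suVU [aU oU]; split; first exact: admissible_local.
by move=> V aV; rewrite purity_final_qubit_local ?oU.
Qed.

(** Spectral decompositions of the two factors supply the product basis, with products of
    eigenvalues as weights. *)
Lemma admissible_product n (rho U : 'M[C]_(2 * n)) (rhoS : 'M[C]_2)
    (rhoB : 'M[C]_n) :
  special_unitary U -> psdmx rhoS -> psdmx rhoB ->
  evolve U rho = rhoS *t rhoB -> admissible rho U.
Proof.
move=> suU /psdmx_spectral[s [eS [oS ->]]] /psdmx_spectral[b [eB [oB ->]]] E.
split=> //; exists (fun i j => s i * b j), eS, eB.
by split=> //; rewrite E spectral_sum_tens.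
Qed.

(** Each of the phases i and -i occurs n times on the diagonal, and i(-i) = 1. *)
Lemma local_phase_det n :
  let d := \row_i (if i == ord0 then 'i else - 'i) : 'rV[C]_2 in
  \det (diag_mx d *t (1%:M : 'M[C]_n)) = 1.
Proof.
move=> d; have -> : diag_mx d *t 1%:M = diag_mx (stack (fun i (_ : 'I_n) => d 0 i))^T.
  apply/matrixP => a b; rewrite [LHS]mxE !mxE mulr_natr -mulrnA mulnb.
  by rewrite -xpair_eqE -!surjective_pairing (can_eq (@mxtens_unindexK _ _)).
rewrite det_diag (reindex (@mxtens_index 2 n)) /=; last first.
  by exists (@mxtens_unindex 2 n) => ? _; rewrite ?mxtens_indexK ?mxtens_unindexK.
under eq_bigr => p _ do rewrite !mxE mxtens_indexK.
rewrite -(pair_bigA _ (fun i (_ : 'I_n) => if i == ord0 then 'i else - 'i : C)) /=.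
rewrite big_ord_recl big_ord1 /= !prodr_const -exprMn mulrN -expr2 sqrCi.
by rewrite opprK expr1n.
Qed.

Lemma optimal_not_unique n (rho U : 'M[C]_(2 * n)) : (0 < n)%N ->
  optimal rho U ->
  exists U' : 'M[C]_(2 * n), optimal rho U' /\ forall c : C, U' <> c *: U.
Proof.
case: n rho U => // n rho U _ oU; have [uU dU] := oU.1.1.
pose d : 'rV[C]_2 := \row_i (if i == ord0 then 'i else - 'i).
pose V := diag_mx d *t (1%:M : 'M[C]_n.+1).
have uD : diag_mx d \is unitarymx.
  apply/unitarymxP; rewrite tr_diag_mx map_diag_mx mulmx_diag.
  apply/matrixP => i j; rewrite !mxE; congr (_ *+ _).
  by case: ifP => _; rewrite -normCK ?normrN normCi expr1n.
have u1 : (1%:M : 'M[C]_n.+1) \is unitarymx.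
  by apply/unitarymxP; rewrite trmx1 map_mx1 mulmx1.
exists (V *m U); split.
  apply: optimal_local => //; split; last by rewrite det_mulmx local_phase_det mul1r.
  by rewrite mul_unitarymx // unitarymx_tens.
(* Cancelling [U] on the right would make [V] equal to c times the identity, but its diagonal
   contains both i and -i. *)
move=> c; rewrite -mul_scalar_mx => /(congr1 (mulmx^~ (U^t*))).
rewrite !mulmxtVK // => /matrixP E.
have := E (mxtens_index (ord0, ord0)) (mxtens_index (ord0, ord0)).
have := E (mxtens_index (ord_max, ord0)) (mxtens_index (ord_max, ord0)).
rewrite !tensmxE !mxE !eqxx !mulr1 /= !mulr1n => <- /eqP.
by rewrite -addr_eq0 -mulr2n mulrn_eq0 (negPf (neq0Ci _)).
Qed.

(** * Characterization of the optimal unitaries *)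

Section Optimality.
Variables (n : nat) (rho : 'M[C]_(2 * n)) (lam : 'I_2 -> 'I_n -> C).
Hypotheses (n_gt0 : (0 < n)%N) (lamR : forall i j, lam i j \is Num.real).
Hypothesis rho_lam : has_eigenvalues rho lam.

(** The weights are the eigenvalues of the evolved state, whose characteristic polynomial is that of
    [rho]. *)
Lemma separable_form_final U (lam' : 'I_2 -> 'I_n -> C) eS eB :
  special_unitary U -> separable_form (evolve U rho) lam' eS eB ->
  let s' i := \sum_j lam' i j in
  [/\ same_up_to_reordering lam lam', final_qubit rho U = spectral_sum s' eS
    & purity (final_qubit rho U) = \sum_i s' i ^+ 2].
Proof.
move=> suU [oS oB E] s'; have F : final_qubit rho U = spectral_sum s' eS.
  by rewrite /final_qubit E ptraceB_product_basis_sum.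
split=> //; last by rewrite F purity_spectral_sum.
apply: (eigenvalues_reordering (A := evolve U rho)).
  by rewrite /has_eigenvalues char_poly_evolve.
by rewrite E; apply: char_poly_product_basis_sum.
Qed.

(** The weights reached by any competitor reorder [lam], hence also [lam'], so the purity bound for
    sorted spectra applies. *)
Lemma first_half_largest_optimal U (lam' : 'I_2 -> 'I_n -> C) eS eB :
  special_unitary U -> separable_form (evolve U rho) lam' eS eB ->
  first_half_largest lam' -> optimal rho U.
Proof.
move=> suU sf fh; split=> [|V [suV [lam'' [eS' [eB' sf']]]]].
  by split=> //; exists lam', eS, eB.
have [ss _ ->] := separable_form_final suU sf.
have [ss' _ ->] := separable_form_final suV sf'.
apply: purity_first_half_ge => //; first exact: reordering_real ss lamR.
by apply: perm_trans ss'; rewrite perm_sym.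
Qed.

(** The unitary [U0] attains a sorted spectrum; an optimal [U] is at least as pure, which is the
    equality case of the bound. *)
Lemma optimal_first_half_largest U0 U (lam0 : 'I_2 -> 'I_n -> C) eS0 eB0 :
  special_unitary U0 -> separable_form (evolve U0 rho) lam0 eS0 eB0 ->
  first_half_largest lam0 -> optimal rho U ->
  exists (lam' : 'I_2 -> 'I_n -> C) eS eB,
    separable_form (evolve U rho) lam' eS eB /\ first_half_largest lam'.
Proof.
move=> su0 sf0 fh0 [[suU [lam' [eS [eB sf]]]] oU].
have a0 : admissible rho U0 by split=> //; exists lam0, eS0, eB0.
have := oU _ a0; have [ss0 _ ->] := separable_form_final su0 sf0.
have [ss _ ->] := separable_form_final suU sf => le.
have ss' : same_up_to_reordering lam0 lam' by apply: perm_trans ss; rewrite perm_sym.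
have [|fh] := purity_first_half_eq n_gt0 (reordering_real ss0 lamR) fh0 ss' le.
  by exists lam', eS, eB.
(* If the largest eigenvalues sit in the second half, exchanging the two vectors of the final qubit
   basis brings them to the first. *)
have [oS oB E] := sf; exists (fun i => lam' (rev_ord i)), (fun i => eS (rev_ord i)), eB.
split=> //; split=> // [i j|]; first by rewrite oS (inj_eq rev_ord_inj).
by rewrite E /product_basis_sum (reindex_inj rev_ord_inj).
Qed.

End Optimality.

End QubitPurity.

Theorem mainTheorem3 (R : realType) (dB : nat)
    (rhoS : 'M[R[i]]_2) (rhoB : 'M[R[i]]_dB)
    (s : 'I_2 -> R[i]) (eS : 'I_2 -> 'cV[R[i]]_2)
    (b : 'I_dB -> R[i]) (eB : 'I_dB -> 'cV[R[i]]_dB)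
    (rhoS_density : density rhoS) (rhoB_density : density rhoB)
    (eS_basis : orthonormal_basis eS) (eB_basis : orthonormal_basis eB)
    (rhoS_eigen : rhoS = spectral_sum s eS)
    (rhoB_eigen : rhoB = spectral_sum b eB) :
  let rho : 'M[R[i]]_(2 * dB) := rhoS *t rhoB in
  let lam := fun (i : 'I_2) (j : 'I_dB) => s i * b j in
  (* the initial joint spectrum *)
  has_eigenvalues rho lam /\
  (* a final product state has the demanded form *)
  (forall (U : 'M[R[i]]_(2 * dB)) (rhoS' : 'M[R[i]]_2) (rhoB' : 'M[R[i]]_dB),
     special_unitary U -> density rhoS' -> density rhoB' ->
     evolve U rho = rhoS' *t rhoB' ->
     final_qubit rho U = rhoS' /\ admissible rho U) /\
  (* final spectrum, final qubit state and its purity *)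
  (forall (U : 'M[R[i]]_(2 * dB)) (lam' : 'I_2 -> 'I_dB -> R[i])
          (eS' : 'I_2 -> 'cV[R[i]]_2) (eB' : 'I_dB -> 'cV[R[i]]_dB),
     special_unitary U -> separable_form (evolve U rho) lam' eS' eB' ->
     let s' := fun i : 'I_2 => \sum_j lam' i j in
     [/\ same_up_to_reordering lam lam',
         final_qubit rho U = spectral_sum s' eS'
       & purity (final_qubit rho U) = \sum_i s' i ^+ 2]) /\
  (* reshuffling the dB largest eigenvalues into the first half is optimal *)
  (forall (U : 'M[R[i]]_(2 * dB)) (lam' : 'I_2 -> 'I_dB -> R[i])
          (eS' : 'I_2 -> 'cV[R[i]]_2) (eB' : 'I_dB -> 'cV[R[i]]_dB),
     special_unitary U -> separable_form (evolve U rho) lam' eS' eB' ->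
     first_half_largest lam' -> optimal rho U) /\
  (* ... and, up to the labelling of the final basis, the only way to be so *)
  (forall U : 'M[R[i]]_(2 * dB), optimal rho U ->
     exists (lam' : 'I_2 -> 'I_dB -> R[i])
            (eS' : 'I_2 -> 'cV[R[i]]_2) (eB' : 'I_dB -> 'cV[R[i]]_dB),
       separable_form (evolve U rho) lam' eS' eB' /\ first_half_largest lam') /\
  (* such a reshuffling exists ... *)
  (exists (p : 'S_(2 * dB)) (lam' : 'I_2 -> 'I_dB -> R[i]),
     perm_mx p *m stack lam = stack lam' /\ first_half_largest lam') /\
  (* ... and its permutation matrix, with the global phase that makes its
     determinant 1, is an optimal choice *)
  (forall (p : 'S_(2 * dB)) (lam' : 'I_2 -> 'I_dB -> R[i]),
     perm_mx p *m stack lam = stack lam' -> first_half_largest lam' ->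
     let P := perm_in_product_basis eS eB p in
     [/\ evolve P rho = product_basis_sum lam' eS eB,
         exists c : R[i], `|c| = 1 /\ special_unitary (c *: P)
       & forall c : R[i], `|c| = 1 -> special_unitary (c *: P) ->
           evolve (c *: P) rho = evolve P rho /\ optimal rho (c *: P)]) /\
  (* local operations leave the qubit purity invariant *)
  (forall (U : 'M[R[i]]_(2 * dB)) (VS : 'M[R[i]]_2) (VB : 'M[R[i]]_dB),
     special_unitary U -> VS \is unitarymx -> VB \is unitarymx ->
     purity (final_qubit rho ((VS *t VB) *m U)) = purity (final_qubit rho U) /\
     (special_unitary ((VS *t VB) *m U) -> optimal rho U ->
      optimal rho ((VS *t VB) *m U))) /\
  (* the optimal unitary is not unique, even up to a global phase *)
  (forall U : 'M[R[i]]_(2 * dB), optimal rho U ->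
     exists U' : 'M[R[i]]_(2 * dB),
       optimal rho U' /\ forall c : R[i], U' <> c *: U).

Proof.
move=> rho lam.
(* A matrix of size zero has trace 0 and cannot be a density matrix. *)
have dB_gt0 : (0 < dB)%N.
  case: (posnP dB) rhoB_density.2 => // dB0.
  rewrite /mxtrace big1 => [/eqP|i _]; first by rewrite eq_sym oner_eq0.
  by case: i => m lt_m; exfalso; rewrite dB0 in lt_m.
have rhoE : rho = product_basis_sum lam eS eB.
  by rewrite /rho rhoS_eigen rhoB_eigen spectral_sum_tens.
have rho_lam : has_eigenvalues rho lam.
  by rewrite rhoE; apply: char_poly_product_basis_sum.
have lamR i j : lam i j \is Num.real.
  have /psdmx_spectral_sum_ge0 s_ge0 : psdmx (spectral_sum s eS).
    by rewrite -rhoS_eigen; case: rhoS_density.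
  have /psdmx_spectral_sum_ge0 b_ge0 : psdmx (spectral_sum b eB).
    by rewrite -rhoB_eigen; case: rhoB_density.
  by rewrite ger0_real // mulr_ge0 ?s_ge0 ?b_ge0.
have permP p (lam' : 'I_2 -> 'I_dB -> R[i]) :
    perm_mx p *m stack lam = stack lam' ->
    let P := perm_in_product_basis eS eB p in
    evolve P rho = product_basis_sum lam' eS eB /\
    exists c : R[i], `|c| = 1 /\ special_unitary (c *: P).
  move=> E P; split; first by rewrite rhoE (evolve_perm_in_product_basis _ _ E).
  apply: special_unitary_phase; first by rewrite muln_gt0.
  exact: perm_in_product_basis_unitary.
have perm_optimal p (lam' : 'I_2 -> 'I_dB -> R[i]) (c : R[i]) :
    perm_mx p *m stack lam = stack lam' -> `|c| = 1 ->
    separable_form (evolve (c *: perm_in_product_basis eS eB p) rho) lam' eS eB.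
  by move=> E c1; split=> //; rewrite evolve_phase //; case: (permP _ _ E).
(* The phased permutation obtained from sorting is the reference optimum against which any other
   optimal unitary is compared. *)
have [p0 [lam0 [E0 fh0]]] := sorting_reshuffle lamR.
have [_ [c0 [c0_1 su0]]] := permP _ _ E0.
split; [by []|split; [|split; [|split; [|split; [|split; [|split; [|split]]]]]]].
- move=> U rhoS' rhoB' suU [psdS trS] [psdB trB] E.
  split; last exact: admissible_product E.
  by rewrite /final_qubit E ptraceB_tens trB scale1r.
- by move=> U lam' eS' eB'; apply: separable_form_final.
- by move=> U lam' eS' eB'; apply: first_half_largest_optimal.
- by move=> U; apply: optimal_first_half_largest su0 (perm_optimal _ _ _ E0 c0_1) fh0.
- by exists p0, lam0.
- move=> p lam' E fh P; have [EP exc] := permP _ _ E; split=> // c c1 suc.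
  split; first exact: evolve_phase.
  exact: first_half_largest_optimal suc (perm_optimal _ _ _ E c1) fh.
- move=> U VS VB _ uS uB; split; first exact: purity_final_qubit_local.
  exact: optimal_local.
- by move=> U; apply: optimal_not_unique.
Qed.
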